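(* Let $N\in\mathbb{N}_0$ and $\lambda\in\mathbb{C}$. Then, as differential operators on spinor fields on $\mathbb{R}^n$ with values in the restriction of the spinor bundle to $\mathbb{R}^{n-1}$, $$\mathbf{D}_{2N}^{BS}(\lambda)=(-2)^N\Big(\lambda-\frac n2-2N+\frac12\Big)_N(2N-1)!!\;\mathbf{D}_{2N}(n-\lambda),$$ $$\mathbf{D}_{2N+1}^{BS}(\lambda)=-(-2)^N\Big(\lambda-\frac n2-2N-\frac12\Big)_N(2N+1)!!\;e_n\cdot\mathbf{D}_{2N+1}(n-\lambda).$$
   Context: Let $n\ge2$ and $e_1,\dots,e_n$ the standard basis of $\mathbb{R}^n$. $(a)_m=a(a+1)\cdots(a+m-1)$, $(a)_0=1$, $(-1)!!=1$, $\mathbb{N}_0=\{0,1,2,\dots\}$. $\Sigma_n$ is the (trivial) spinor bundle of Euclidean $\mathbb{R}^n$ associated with the irreducible spin representation for $n$ odd and the half-spin representation $\mathbb{S}_n^+$ for $n$ even; Clifford multiplication $\cdot$ satisfies $x\cdot y+y\cdot x=-2\langle x,y\rangle$, and products of Clifford multiplications are understood on the spinor module. $\mathsf{D}=\sum_{k=1}^ne_k\cdot\partial_k$ is the Dirac operator, $\mathsf{D}'=\sum_{k=1}^{n-1}e_k\cdot\partial_k$ the tangential Dirac operator, $\Delta=\sum_{k=1}^n\partial_k^2$, $\Delta'=\sum_{k=1}^{n-1}\partial_k^2$, and $\iota^*$ is restriction to $\{x_n=0\}=\mathbb{R}^{n-1}$. Define $$\mathbf{P}(\lambda)\varphi=(n-2\lambda+1)\partial_n\varphi+\mathsf{D}(e_n\cdot\varphi)+\Delta(x_n\varphi)$$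 and the Bernstein-Sato family for spinors $$\mathbf{D}^{BS}_N(\lambda)=\iota^*\mathbf{P}(\lambda-N+1)\circ\cdots\circ\mathbf{P}(\lambda-1)\circ\mathbf{P}(\lambda)$$ ($N$ factors; $\mathbf{D}_0^{BS}(\lambda)=\iota^*$). Let $$D_{2N}(\lambda)=\sum_{k=0}^Na_k^{(N)}(-\lambda)(\Delta')^k\iota^*\partial_n^{2N-2k},\qquad D_{2N+1}(\lambda)=\sum_{k=0}^Nb_k^{(N)}(-\lambda)(\Delta')^k\iota^*\partial_n^{2N-2k+1},$$ $$a_j^{(N)}(\lambda)=\frac{(-2)^{N-j}N!}{j!(2N-2j)!}\prod_{k=j}^{N-1}(2\lambda-4N+2k+n+1),\qquad b_j^{(N)}(\lambda)=\frac{(-2)^{N-j}N!}{j!(2N-2j+1)!}\prod_{k=j}^{N-1}(2\lambda-4N+2k+n-1)$$ (empty products equal $1$), acting componentwise on spinor fields. The conformal symmetry breaking differential operators on spinors are $$\mathbf{D}_{2N}(\lambda)=D_{2N}(\lambda+\tfrac12)+2N\,D_{2N-1}(\lambda+\tfrac12)\,\mathsf{D}'(e_n\cdot),$$ $$\mathbf{D}_{2N+1}(\lambda)=(2\lambda-n+2N+2)\,D_{2N+1}(\lambda+\tfrac12)(e_n\cdot)+D_{2N}(\lambda+\tfrac12)\,\mathsf{D}',$$ where for $N=0$ the term with factor $2N$ is omitted. *)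

(* Defs.v *)
From mathcomp Require Import all_boot all_order all_algebra.
From mathcomp Require Import all_classical all_reals all_analysis.
From mathcomp Require Import complex.

Set Implicit Arguments.
Unset Strict Implicit.
Unset Printing Implicit Defensive.

Import Order.TTheory GRing.Theory Num.Theory.
Import numFieldNormedType.Exports.

Local Open Scope complex_scope.
Local Open Scope ring_scope.

Section SpinorModule.
Variables (R : realType) (n d : nat).

(* Clifford multiplication on C^d is recorded by the matrices E i of the basis
   vectors e_i, which act on column vectors from the left. *)
Implicit Type E : 'I_n -> 'M[R[i]]_d.

Definition clifford E (x : 'rV[R]_n) : 'M[R[i]]_d :=
  \sum_i (x 0 i)%:C *: E i.

Definition clifford_module E : Prop :=
  forall x y : 'rV[R]_n,
    clifford E x *m clifford E y + clifford E y *m clifford E x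
    = (- (2 * \sum_i x 0 i * y 0 i)%:C)%:M.

Definition irreducible_module E : Prop :=
  (0 < d)%N /\
  forall W : {vspace 'cV[R[i]]_d},
    (forall i v, v \in W -> E i *m v \in W) -> W = 0%VS \/ W = fullv.

(* The complex volume element i^[(n+1)/2] e_1 ... e_n, which squares to 1. *)
Definition volume E : 'M[R[i]]_d :=
  ('i%C) ^+ (n.+1)./2 *: \big[mulmx/1%:M]_(i < n) E i.

(* The spin representation is the restriction to Spin(n) of an irreducible
   complex Clifford module.  It is the whole module for n odd; for n even the
   half-spin module S_n^+ is the +1-eigenspace of the volume element, which
   Clifford multiplication by a vector exchanges with the -1-eigenspace. *)
Definition spinor E (v : 'cV[R[i]]_d) : Prop :=
  odd n \/ volume E *m v = v.

End SpinorModule.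

Section Fields.
Variables (R : realType) (d : nat).

Definition partial_real p (k : 'I_p) (f : 'rV[R]_p -> R) : 'rV[R]_p -> R :=
  fun x => 'D_(delta_mx 0 k) f x.

(* C^infinity: every iterated partial derivative is continuous and has partial
   derivatives in all coordinate directions. *)
Definition smooth_real p (f : 'rV[R]_p -> R) : Prop :=
  forall s : seq 'I_p, let g := foldr (@partial_real p) f s in
    continuous g /\ forall (k : 'I_p) x, derivable g x (delta_mx 0 k).

Definition smooth p (phi : 'rV[R]_p -> 'cV[R[i]]_d) : Prop :=
  forall j : 'I_d, smooth_real (fun x => complex.Re (phi x j 0)) /\
                   smooth_real (fun x => complex.Im (phi x j 0)).

Definition partial p (k : 'I_p) (phi : 'rV[R]_p -> 'cV[R[i]]_d) :
    'rV[R]_p -> 'cV[R[i]]_d :=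
  fun x => \col_j (partial_real k (fun y => complex.Re (phi y j 0)) x +i*
                   partial_real k (fun y => complex.Im (phi y j 0)) x).

Definition laplacian p (phi : 'rV[R]_p -> 'cV[R[i]]_d) :
    'rV[R]_p -> 'cV[R[i]]_d :=
  fun x => \sum_(k < p) partial k (partial k phi) x.

End Fields.

(* n = m.+1; x_n is the coordinate of index ord_max, and the tangential
   coordinates x_1, ..., x_(n-1) are those of index lift ord_max k. *)
Section Operators.
Variables (R : realType) (m d : nat) (E : 'I_m.+1 -> 'M[R[i]]_d).
Local Notation field := ('rV[R]_m.+1 -> 'cV[R[i]]_d).
Local Notation bdfield := ('rV[R]_m -> 'cV[R[i]]_d).
Implicit Types (phi : field) (lambda : R[i]).

Definition spinor_field phi : Prop := smooth phi /\ forall x, spinor E (phi x).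

Definition hyperplane (y : 'rV[R]_m) : 'rV[R]_m.+1 :=
  \row_j (if unlift ord_max j is Some k then y 0 k else 0).

Definition restr phi : bdfield := fun y => phi (hyperplane y).

Definition dn phi : field := partial ord_max phi.

Definition en_mul phi : field := fun x => E ord_max *m phi x.

Definition xn_mul phi : field := fun x => (x 0 ord_max)%:C *: phi x.

Definition dirac phi : field :=
  fun x => \sum_(k < m.+1) E k *m partial k phi x.

Definition tdirac phi : field :=
  fun x => \sum_(k < m) E (lift ord_max k) *m partial (lift ord_max k) phi x.

Definition Pop lambda phi : field := fun x =>
  (m.+1%:R - 2 * lambda + 1) *: dn phi x + dirac (en_mul phi) x
  + laplacian (xn_mul phi) x.

(* P(lambda - N + 1) o ... o P(lambda - 1) o P(lambda) *)
Fixpoint Piter (N : nat) lambda phi : field :=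
  if N is N'.+1 then Pop (lambda - N'%:R) (Piter N' lambda phi) else phi.

Definition DBS (N : nat) lambda phi : bdfield := restr (Piter N lambda phi).

Definition coef_a (N j : nat) lambda : R[i] :=
  (- 2) ^+ (N - j) * N`!%:R / (j`!%:R * (2 * N - 2 * j)`!%:R)
  * \prod_(j <= k < N) (2 * lambda - 4 * N%:R + 2 * k%:R + m.+1%:R + 1).

Definition coef_b (N j : nat) lambda : R[i] :=
  (- 2) ^+ (N - j) * N`!%:R / (j`!%:R * (2 * N - 2 * j + 1)`!%:R)
  * \prod_(j <= k < N) (2 * lambda - 4 * N%:R + 2 * k%:R + m.+1%:R - 1).

(* D_(2N)(lambda) and D_(2N+1)(lambda) *)
Definition D_even (N : nat) lambda phi : bdfield := fun y =>
  \sum_(k < N.+1) coef_a N k (- lambda) *: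
    iter k (@laplacian R d m) (restr (iter (2 * N - 2 * k) dn phi)) y.

Definition D_odd (N : nat) lambda phi : bdfield := fun y =>
  \sum_(k < N.+1) coef_b N k (- lambda) *:
    iter k (@laplacian R d m) (restr (iter (2 * N - 2 * k + 1) dn phi)) y.

(* The bold operators; D_(2N-1) is D_odd (N - 1). *)
Definition bD_even (N : nat) lambda phi : bdfield := fun y =>
  D_even N (lambda + 2^-1) phi y
  + (if N is N'.+1
     then (2 * N%:R) *: D_odd N' (lambda + 2^-1) (tdirac (en_mul phi)) y
     else 0).

Definition bD_odd (N : nat) lambda phi : bdfield := fun y =>
  (2 * lambda - m.+1%:R + 2 * N%:R + 2) *: D_odd N (lambda + 2^-1) (en_mul phi) y
  + D_even N (lambda + 2^-1) (tdirac phi) y.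

End Operators.

Definition pochhammer (A : pzRingType) (a : A) (m : nat) : A :=
  \prod_(i < m) (a + i%:R).

(* With truncated subtraction, dfact (2 * 0 - 1) = dfact 0 = 1 = (-1)!!. *)
Fixpoint dfact (k : nat) : nat := if k is k'.+2 then (k * dfact k')%N else 1%N.

(* Main.v *)
From HB Require Import structures.
Require Import Defs.
From mathcomp Require Import all_boot all_order all_algebra.
From mathcomp Require Import all_classical all_reals all_analysis.
From mathcomp Require Import complex.
From mathcomp Require Import ring zify.
Import Order.TTheory GRing.Theory Num.Theory.
Import numFieldNormedType.Exports.
Local Open Scope complex_scope.
Local Open Scope ring_scope.

Set Implicit Arguments.
Unset Strict Implicit.
Unset Printing Implicit Defensive.

(** The identity takes place in a Weyl algebra.  Put T = D' e_n (Clifford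
    multiplication by e_n followed by the tangential Dirac operator).  Since
    e_n anticommutes with the other e_k and squares to -1, T^2 = - Delta', and
    expanding D (e_n phi) and Delta (x_n phi) gives

      P(lambda) = c d_n + T + x_n (d_n^2 - T^2),   c = n - 2 lambda + 2,

    where [d_n, x_n] = 1 and T commutes with d_n and x_n
    ([Pop_sfield], [Piter_sfield]).  Restriction to x_n = 0 kills everything
    that starts with x_n, so pulling d_n^m through P(lambda) yields

      iota d_n^m P = (c + m) iota d_n^(m+1) + T iota d_n^m
                     - m T^2 iota d_n^(m-1),

    and splitting off the factor of the M-fold product that acts first gives a
    three-term recurrence for the coefficients f_(M,j) of T^j iota d_n^(M-j).
    In terms of w = 2 lambda - n - 2 M, a quantity that does not change when
    (M, lambda) is replaced by (M-1, lambda-1), it reads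

      f_(M+1,j) = - (w + M + j) f_(M,j) + f_(M,j-1) - (M - j + 2) f_(M,j-2)

    and is solved by one product formula valid for both parities of M and j,

      f_(M,j) = (-1)^(M+j) (M)_j / (2^k k!)
                * prod of (w + v) over v < M with v odd or v >= j,

    with k = floor(j/2) and (M)_j the falling factorial ([bs_coef],
    [bs_coefSS], [rho_weyl_iter]).  The odd factors v make up the Pochhammer
    symbol in front of the operator, the even ones the products inside the
    coefficients a and b, and M! = M!! (M-1)!! accounts for the double
    factorial ([bs_coef_even_even] and its three companions).  Finally
    T^(2k) = (-Delta')^k turns the even powers of T into tangential Laplacians
    and the odd ones into the terms that contain D'.

    The analytic input is that these operators act on smooth fields and that
    partial derivatives of smooth functions commute.  The latter is Schwarz's
    theorem, proved by applying the mean value theorem twice to a second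
    difference ([derive_comm]).  Smooth fields are then bundled into a module
    over the complex numbers on which partial derivatives, constant matrices
    and coordinates act linearly ([sfield]), and all further computations are
    algebra in that module. *)

(** * Schwarz's theorem for directional derivatives *)

Lemma is_derive_lin (R : realType) (V : normedModType R) (f g : V -> R)
    (a b df dg : R) (x v : V) : is_derive x v f df -> is_derive x v g dg ->
  is_derive x v (fun y => a * f y + b * g y) (a * df + b * dg).
Proof.
move=> hf hg.
exact: (@is_deriveD _ _ _ (a \*: f) (b \*: g) _ _ _ _
          (is_deriveZ _ hf) (is_deriveZ _ hg)).
Qed.

Lemma is_derive_mul (R : realType) (V : normedModType R) (f g : V -> R)
    (df dg : R) (x v : V) : is_derive x v f df -> is_derive x v g dg ->
  is_derive x v (fun y => f y * g y) (f x * dg + df * g x).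
Proof. by move=> hf hg; rewrite [df * _]mulrC; exact: (is_deriveM hf hg). Qed.

Lemma continuous_lin (R : realType) (T : topologicalType) (f g : T -> R)
    (a b : R) : continuous f -> continuous g ->
  continuous (fun y => a * f y + b * g y).
Proof.
have scale_cont c (h : T -> R) : continuous h -> continuous (fun y => c * h y).
  have cc : continuous (cst c : T -> R) by apply: cst_continuous.
  by move=> ch x; exact: (continuousM (cc x) (ch x)).
by move=> cf cg x; exact: (continuousD (scale_cont a f cf x) (scale_cont b g cg x)).
Qed.

Lemma continuous_mul (R : realType) (T : topologicalType) (f g : T -> R) :
  continuous f -> continuous g -> continuous (fun y => f y * g y).
Proof. by move=> cf cg x; exact: (continuousM (cf x) (cg x)). Qed.

Lemma is_derive_shift (R : realType) (V W : normedModType R) (f : V -> W)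
    (x w v : V) (df : W) :
  is_derive (w + x) v f df -> is_derive x v (fun y => f (w + y)) df.
Proof.
have quotE : (fun h : R => h^-1 *: (((fun y => f (w + y)) \o shift x) (h *: v)
    - f (w + x)))
  = (fun h : R => h^-1 *: ((f \o shift (w + x)) (h *: v) - f (w + x))).
  by apply/funext => h /=; rewrite addrCA.
by move=> [df1 df2]; apply: DeriveDef; rewrite /derivable /derive quotE.
Qed.

Lemma is_derive_line (R : realType) (V W : normedModType R) (f : V -> W)
    (x v : V) (s : R) (df : W) :
  is_derive (s *: v + x) v f df ->
  is_derive s (1 : R) (fun t : R => f (t *: v + x)) df.
Proof.
have quotE : (fun h : R => h^-1 *: (((fun t => f (t *: v + x)) \o shift s)
    (h *: (1 : R)) - f (s *: v + x)))
  = (fun h : R => h^-1 *: ((f \o shift (s *: v + x)) (h *: v) - f (s *: v + x))).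
  by apply/funext => h /=; rewrite [h *: 1]mulr1 scalerDl addrA.
by move=> [df1 df2]; apply: DeriveDef; rewrite /derivable /derive quotE.
Qed.

Lemma MVT_line (R : realType) (V : normedModType R) (f df : V -> R)
    (v x : V) (h : R) : (forall y, is_derive y v f (df y)) -> 0 < h ->
  exists2 s, 0 < s < h & f (h *: v + x) - f x = h * df (s *: v + x).
Proof.
move=> dfE h0.
have dl s : is_derive s (1 : R) (fun t : R => f (t *: v + x)) (df (s *: v + x)).
  exact: is_derive_line.
have [|s] := MVT h0 (fun s _ => dl s).
  by apply: derivable_within_continuous => s _; case: (dl s).
rewrite in_itv /= => sh; rewrite scale0r add0r subr0 mulrC => ->.
by exists s.
Qed.

(** The mean value theorem is applied first along u to the increment of f along
    v, then along v to the derivative of f along u. *)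
Lemma MVT_second_difference (R : realType) (V : normedModType R)
    (f fu fuv : V -> R) (u v x : V) (h : R) :
  (forall y, is_derive y u f (fu y)) -> (forall y, is_derive y v fu (fuv y)) ->
  0 < h ->
  exists s t, [/\ 0 < s < h, 0 < t < h &
    f (h *: v + (h *: u + x)) - f (h *: u + x) - (f (h *: v + x) - f x)
    = h ^+ 2 * fuv (t *: v + (s *: u + x))].
Proof.
move=> dfu dfuv h0; pose g y := f (h *: v + y) - f y.
have dg y : is_derive y u g (fu (h *: v + y) - fu y).
  by apply: is_deriveB; exact: is_derive_shift.
have [s sh Es] := MVT_line x dg h0.
have [t th Et] := MVT_line (s *: u + x) dfuv h0.
exists s, t; split=> //.
by rewrite -[LHS]/(g (h *: u + x) - g x) Es Et expr2 -mulrA.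
Qed.

(** The second difference of f with steps h u and h v does not depend on the
    order in which the two differences are taken, so [MVT_second_difference]
    makes fuv at one point of the h-parallelogram at x equal to fvu at another
    one; continuity at x concludes as h tends to 0. *)
Lemma derive_comm (R : realType) (V : normedModType R)
    (f fu fv fuv fvu : V -> R) (u v x : V) :
  (forall y, is_derive y u f (fu y)) -> (forall y, is_derive y v fu (fuv y)) ->
  (forall y, is_derive y v f (fv y)) -> (forall y, is_derive y u fv (fvu y)) ->
  {for x, continuous fuv} -> {for x, continuous fvu} -> fuv x = fvu x.
Proof.
move=> dfu dfuv dfv dfvu cuv cvu.
apply/eqP; rewrite -subr_eq0 -normr_le0; apply/ler_addgt0Pl => e e0; rewrite addr0.
have e2 : 0 < e / 2 by rewrite divr_gt0.
have /cvgrPdist_lt /(_ _ e2) := cvu; have /cvgrPdist_lt /(_ _ e2) := cuv.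
move=> /nbhs_ballP [r1 /= r10 near1] /nbhs_ballP [r2 /= r20 near2].
pose r := Num.min r1 r2; have r0 : 0 < r by rewrite lt_min r10 r20.
(* The added 1 keeps c positive when u and v both vanish. *)
pose c := `|u| + `|v| + 1.
have c0 : 0 < c by rewrite ltr_pwDr // addr_ge0.
pose h := r / c; have h0 : 0 < h by rewrite divr_gt0.
have inball (a b : V) s t : 0 < s < h -> 0 < t < h -> `|a| + `|b| + 1 = c ->
    ball x r (t *: b + (s *: a + x)).
  move=> /andP [s0 sh] /andP [t0 th] cE; rewrite -ball_normE /= distrC addrA addrK.
  rewrite (le_lt_trans (ler_normD _ _)) // !normrZ !gtr0_norm //.
  have -> : r = h * c by rewrite /h divfK // gt_eqF.
  rewrite -cE !mulrDr mulr1 [X in X < _]addrC ltr_pwDr //.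
  by apply: lerD; apply: ler_wpM2r => //; exact: ltW.
have [s [t [sh th E1]]] := MVT_second_difference x dfu dfuv h0.
have [s' [t' [sh' th' E2]]] := MVT_second_difference x dfv dfvu h0.
have E : fuv (t *: v + (s *: u + x)) = fvu (t' *: u + (s' *: v + x)).
  apply: (@mulfI _ (h ^+ 2)); first by rewrite expf_neq0 // gt_eqF.
  by rewrite -E1 -E2 [h *: v + (_ + _)]addrCA; ring.
have b1 : `|fuv x - fuv (t *: v + (s *: u + x))| < e / 2.
  by apply: near1; apply: (@le_ball _ _ x r); [rewrite ge_min lexx|exact: inball].
have b2 : `|fvu x - fvu (t' *: u + (s' *: v + x))| < e / 2.
  apply: near2; apply: (@le_ball _ _ x r); first by rewrite ge_min lexx orbT.
  by apply: inball => //; rewrite [`|v| + _]addrC.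
rewrite -E distrC in b2; rewrite ltW // [e]splitr.
rewrite (le_lt_trans _ (ltrD b1 b2)) //.
by rewrite (le_trans _ (ler_normD _ _)) // addrA subrK.
Qed.

(** * Smooth real functions of several variables *)

(** Smoothness is the largest class of continuous functions closed under partial
    derivatives, so it can be proved by coinduction: the closure properties
    below exhibit such a class. *)
Lemma smooth_real_coind (R : realType) (p : nat)
    (C : ('rV[R]_p -> R) -> Prop) :
  (forall f, C f -> continuous f) ->
  (forall f (k : 'I_p), C f -> exists2 df, C df &
     forall x, is_derive x (delta_mx 0 k) f (df x)) ->
  forall f, C f -> smooth_real f.
Proof.
move=> Ccont Cder.
have Cpart k f : C f -> C (partial_real k f).
  move=> /Cder-/(_ k) [df Cdf fdf].
  suff -> : partial_real k f = df by [].
  by apply/funext => x; case: (fdf x).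
move=> f Cf s; have Cg : C (foldr (@partial_real R p) f s).
  by elim: s => [|k s IHs] //=; exact: Cpart.
split; first exact: Ccont.
by move=> k x; have [df _ fdf] := Cder _ k Cg; case: (fdf x).
Qed.

Lemma smooth_real_continuous (R : realType) (p : nat) (f : 'rV[R]_p -> R) :
  smooth_real f -> continuous f.
Proof. by move=> /(_ [::]) []. Qed.

Lemma smooth_real_is_derive (R : realType) (p : nat) (f : 'rV[R]_p -> R)
    (k : 'I_p) (x : 'rV[R]_p) :
  smooth_real f -> is_derive x (delta_mx 0 k) f (partial_real k f x).
Proof. by move=> /(_ [::]) [_ df]; exact: derivableP. Qed.

Lemma is_derive_partial (R : realType) (p : nat) (f df : 'rV[R]_p -> R)
    (k : 'I_p) :
  (forall x, is_derive x (delta_mx 0 k) f (df x)) -> partial_real k f = df.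
Proof. by move=> fdf; apply/funext => x; case: (fdf x). Qed.

Lemma smooth_real_partial (R : realType) (p : nat) (k : 'I_p)
    (f : 'rV[R]_p -> R) :
  smooth_real f -> smooth_real (partial_real k f).
Proof. by move=> sf s; have := sf (rcons s k); rewrite foldr_rcons. Qed.

Lemma partial_real_lin (R : realType) (p : nat) (k : 'I_p) (a b : R)
    (f g : 'rV[R]_p -> R) : smooth_real f -> smooth_real g ->
  partial_real k (fun x => a * f x + b * g x)
  = fun x => a * partial_real k f x + b * partial_real k g x.
Proof.
move=> sf sg; apply: is_derive_partial => x.
exact: (is_derive_lin a b (smooth_real_is_derive k x sf)
                          (smooth_real_is_derive k x sg)).
Qed.

Lemma smooth_real_lin (R : realType) (p : nat) (a b : R)
    (f g : 'rV[R]_p -> R) : smooth_real f -> smooth_real g ->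
  smooth_real (fun x => a * f x + b * g x).
Proof.
move=> sf sg.
apply: (@smooth_real_coind _ _ (fun h => exists f g, [/\ smooth_real f,
  smooth_real g & h = fun x => a * f x + b * g x])); last by exists f, g.
- move=> _ [{sf sg}f [{}g [sf sg ->]]].
  exact: (continuous_lin (smooth_real_continuous sf) (smooth_real_continuous sg)).
- move=> _ k [{sf sg}f [{}g [sf sg ->]]].
  exists (fun x => a * partial_real k f x + b * partial_real k g x).
    exists (partial_real k f), (partial_real k g).
    split; [exact: smooth_real_partial..|reflexivity].
  move=> x; exact: (is_derive_lin a b (smooth_real_is_derive k x sf)
                                      (smooth_real_is_derive k x sg)).
Qed.

Lemma is_derive_coord (R : realType) (p : nat) (k l : 'I_p) (x : 'rV[R]_p) :
  is_derive x (delta_mx 0 k) (fun y : 'rV[R]_p => y 0 l) (l == k)%:R.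
Proof.
have quotE : ((fun h : R => h^-1 *: (((fun y : 'rV[R]_p => y 0 l) \o shift x)
    (h *: delta_mx 0 k) - x 0 l) : R) @ 0^' --> ((l == k)%:R : R))%classic.
  apply: cvg_near_cst; near=> h.
  have h0 : h != 0 by near: h; exact: nbhs_dnbhs_neq.
  by rewrite /= !mxE addrK eqxx scalerA mulVf // scale1r.
by apply: DeriveDef; [apply/cvg_ex; exists (l == k)%:R|exact: cvg_lim quotE].
Unshelve. all: by end_near.
Qed.

Lemma partial_real_coord_mul (R : realType) (p : nat) (k l : 'I_p)
    (f : 'rV[R]_p -> R) : smooth_real f ->
  partial_real k (fun x => x 0 l * f x)
  = fun x => x 0 l * partial_real k f x + (l == k)%:R * f x.
Proof.
move=> sf; apply: is_derive_partial => x.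
exact: (is_derive_mul (is_derive_coord k l x) (smooth_real_is_derive k x sf)).
Qed.

Lemma smooth_real_coord_mul (R : realType) (p : nat) (l : 'I_p)
    (f : 'rV[R]_p -> R) :
  smooth_real f -> smooth_real (fun x => x 0 l * f x).
Proof.
move=> sf.
(* Differentiating x_l f produces x_l f' plus possibly f, so the class has to
   contain all functions x_l f + g. *)
apply: (@smooth_real_coind _ _ (fun h => exists f g, [/\ smooth_real f,
  smooth_real g & h = fun x => 1 * (x 0 l * f x) + 1 * g x])).
- move=> _ [{sf}f [g [sf sg ->]]].
  apply: continuous_lin; last exact: smooth_real_continuous.
  have cl : continuous (fun x : 'rV[R]_p => x 0 l) by apply: coord_continuous.
  exact: (continuous_mul cl (smooth_real_continuous sf)).
- move=> _ k [{sf}f [g [sf sg ->]]].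
  pose f' (x : 'rV[R]_p) := x 0 l * partial_real k f x + (l == k)%:R * f x.
  exists (fun x => 1 * f' x + 1 * partial_real k g x).
    exists (partial_real k f), (fun x => (l == k)%:R * f x + 1 * partial_real k g x).
    split; first exact: smooth_real_partial.
      exact: (smooth_real_lin _ _ sf (smooth_real_partial k sg)).
    by apply/funext => x; rewrite /f' !mul1r addrA.
  move=> x; exact: (is_derive_lin 1 1
    (is_derive_mul (is_derive_coord k l x) (smooth_real_is_derive k x sf))
    (smooth_real_is_derive k x sg)).
- exists f, (fun x => 0 * f x + 0 * f x).
  split; [exact: sf|exact: smooth_real_lin|].
  by apply/funext => x; rewrite !mul0r !addr0 mulr0 addr0 mul1r.
Qed.

Lemma partial_realC (R : realType) (p : nat) (k l : 'I_p) (f : 'rV[R]_p -> R) :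
  smooth_real f ->
  partial_real k (partial_real l f) = partial_real l (partial_real k f).
Proof.
move=> sf; apply/funext => x.
have sp i := smooth_real_partial i sf.
exact: (derive_comm (fun y => smooth_real_is_derive l y sf)
  (fun y => smooth_real_is_derive k y (sp l))
  (fun y => smooth_real_is_derive k y sf)
  (fun y => smooth_real_is_derive l y (sp k))
  (smooth_real_continuous (smooth_real_partial k (sp l)) (x:=x))
  (smooth_real_continuous (smooth_real_partial l (sp k)) (x:=x))).
Qed.

(** * Smooth complex functions and smooth fields *)

Lemma is_derive_zero (R : realType) (p : nat) (k : 'I_p) (x : 'rV[R]_p) :
  is_derive x (delta_mx 0 k) (fun=> 0 : R) 0.
Proof. exact: is_derive_cst. Qed.

Lemma smooth_real0 (R : realType) (p : nat) :
  smooth_real (fun _ : 'rV[R]_p => 0 : R).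
Proof.
apply: (@smooth_real_coind _ _ (fun f => f = fun=> 0)) => [_ ->|_ k ->|//].
  by move=> x; exact: cst_continuous.
by exists (fun=> 0) => // x; exact: is_derive_zero.
Qed.

Lemma partial_real0 (R : realType) (p : nat) (k : 'I_p) :
  partial_real k (fun _ : 'rV[R]_p => 0 : R) = fun=> 0.
Proof. by apply: is_derive_partial => x; exact: is_derive_zero. Qed.

Definition csmooth (R : realType) (p : nat) (f : 'rV[R]_p -> R[i]) : Prop :=
  smooth_real (fun x => complex.Re (f x)) /\
  smooth_real (fun x => complex.Im (f x)).

Definition cpartial (R : realType) (p : nat) (k : 'I_p)
    (f : 'rV[R]_p -> R[i]) (x : 'rV[R]_p) : R[i] :=
  partial_real k (fun y => complex.Re (f y)) x +i*
  partial_real k (fun y => complex.Im (f y)) x.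

Lemma csmooth_cpartial (R : realType) (p : nat) (k : 'I_p)
    (f : 'rV[R]_p -> R[i]) : csmooth f -> csmooth (cpartial k f).
Proof. by move=> [fr fi]; split; exact: smooth_real_partial. Qed.

Lemma cpartialC (R : realType) (p : nat) (k l : 'I_p) (f : 'rV[R]_p -> R[i]) :
  csmooth f -> cpartial k (cpartial l f) = cpartial l (cpartial k f).
Proof.
move=> [fr fi]; apply/funext => x.
exact: (congr2 (fun u v : 'rV[R]_p -> R => u x +i* v x)
  (partial_realC k l fr) (partial_realC k l fi)).
Qed.

Lemma csmoothZ (R : realType) (p : nat) (c : R[i]) (f : 'rV[R]_p -> R[i]) :
  csmooth f -> csmooth (fun x => c * f x).
Proof.
case: c => a b [fr fi]; split.
  have -> : (fun x => complex.Re ((a +i* b) * f x))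
     = fun x => a * complex.Re (f x) + (- b) * complex.Im (f x).
    by apply/funext => x; case: (f x) => u v /=; rewrite mulNr.
  exact: smooth_real_lin.
have -> : (fun x => complex.Im ((a +i* b) * f x))
     = fun x => a * complex.Im (f x) + b * complex.Re (f x).
  by apply/funext => x; case: (f x) => u v /=.
exact: smooth_real_lin.
Qed.

Lemma cpartialZ (R : realType) (p : nat) (k : 'I_p) (c : R[i])
    (f : 'rV[R]_p -> R[i]) : csmooth f ->
  cpartial k (fun x => c * f x) = fun x => c * cpartial k f x.
Proof.
case: c => a b [fr fi]; apply/funext => x; rewrite /cpartial.
have -> : (fun x => complex.Re ((a +i* b) * f x))
     = fun x => a * complex.Re (f x) + (- b) * complex.Im (f x).
  by apply/funext => y; case: (f y) => u v /=; rewrite mulNr.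
have -> : (fun x => complex.Im ((a +i* b) * f x))
     = fun x => a * complex.Im (f x) + b * complex.Re (f x).
  by apply/funext => y; case: (f y) => u v /=.
by rewrite (partial_real_lin k a (- b) fr fi) (partial_real_lin k a b fi fr) mulNr.
Qed.

Lemma smooth_realD (R : realType) (p : nat) (f g : 'rV[R]_p -> R) :
  smooth_real f -> smooth_real g -> smooth_real (fun x => f x + g x).
Proof.
move=> sf sg; have -> : (fun x => f x + g x) = fun x => 1 * f x + 1 * g x.
  by apply/funext => x; rewrite !mul1r.
exact: smooth_real_lin.
Qed.

Lemma partial_realD (R : realType) (p : nat) (k : 'I_p) (f g : 'rV[R]_p -> R) :
  smooth_real f -> smooth_real g ->
  partial_real k (fun x => f x + g x)
  = fun x => partial_real k f x + partial_real k g x.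
Proof.
move=> sf sg; have -> : (fun x => f x + g x) = fun x => 1 * f x + 1 * g x.
  by apply/funext => x; rewrite !mul1r.
by rewrite (partial_real_lin k 1 1 sf sg); apply/funext => x; rewrite !mul1r.
Qed.

Lemma ReD_fun (R : realType) (T : Type) (f g : T -> R[i]) :
  (fun x => complex.Re (f x + g x)) = fun x => complex.Re (f x) + complex.Re (g x).
Proof. by apply/funext => x; case: (f x) (g x) => ? ? []. Qed.

Lemma ImD_fun (R : realType) (T : Type) (f g : T -> R[i]) :
  (fun x => complex.Im (f x + g x)) = fun x => complex.Im (f x) + complex.Im (g x).
Proof. by apply/funext => x; case: (f x) (g x) => ? ? []. Qed.

Lemma csmoothD (R : realType) (p : nat) (f g : 'rV[R]_p -> R[i]) :
  csmooth f -> csmooth g -> csmooth (fun x => f x + g x).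
Proof.
by move=> [fr fi] [gr gi]; rewrite /csmooth ReD_fun ImD_fun; split;
  exact: smooth_realD.
Qed.

Lemma cpartialD (R : realType) (p : nat) (k : 'I_p) (f g : 'rV[R]_p -> R[i]) :
  csmooth f -> csmooth g ->
  cpartial k (fun x => f x + g x) = fun x => cpartial k f x + cpartial k g x.
Proof.
move=> [fr fi] [gr gi]; apply/funext => x; rewrite /cpartial ReD_fun ImD_fun.
by rewrite (partial_realD k fr gr) (partial_realD k fi gi).
Qed.

Lemma sum_cons_fun (R : realType) (T I : Type) (i : I) (r : seq I)
    (F : I -> T -> R[i]) :
  (fun x => \sum_(j <- i :: r) F j x) = fun x => F i x + \sum_(j <- r) F j x.
Proof. by apply/funext => x; rewrite big_cons. Qed.

Lemma csmooth_sum (R : realType) (p : nat) (I : Type) (r : seq I)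
    (F : I -> 'rV[R]_p -> R[i]) : (forall i, csmooth (F i)) ->
  csmooth (fun x => \sum_(i <- r) F i x).
Proof.
move=> sF; elim: r => [|i r IHr]; last first.
  by rewrite sum_cons_fun; exact: (csmoothD (sF i) IHr).
have -> : (fun x => \sum_(i <- [::]) F i x) = fun=> 0.
  by apply/funext => x; rewrite big_nil.
by split; exact: smooth_real0.
Qed.

Lemma cpartial_sum (R : realType) (p : nat) (k : 'I_p) (I : Type) (r : seq I)
    (F : I -> 'rV[R]_p -> R[i]) : (forall i, csmooth (F i)) ->
  cpartial k (fun x => \sum_(i <- r) F i x)
  = fun x => \sum_(i <- r) cpartial k (F i) x.
Proof.
move=> sF; elim: r => [|i r IHr]; last first.
  by rewrite sum_cons_fun (cpartialD k (sF i) (csmooth_sum r sF)) IHr sum_cons_fun.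
have -> : (fun x => \sum_(i <- [::]) F i x) = fun=> 0.
  by apply/funext => x; rewrite big_nil.
by apply/funext => x; rewrite big_nil /cpartial partial_real0.
Qed.

Lemma Re_coord_mul (R : realType) (p : nat) (l : 'I_p) (f : 'rV[R]_p -> R[i]) :
  (fun x : 'rV[R]_p => complex.Re ((x 0 l)%:C * f x)) = fun x => x 0 l * complex.Re (f x).
Proof. by apply/funext => x; case: (f x) => ? ? /=; rewrite mul0r subr0. Qed.

Lemma Im_coord_mul (R : realType) (p : nat) (l : 'I_p) (f : 'rV[R]_p -> R[i]) :
  (fun x : 'rV[R]_p => complex.Im ((x 0 l)%:C * f x)) = fun x => x 0 l * complex.Im (f x).
Proof. by apply/funext => x; case: (f x) => ? ? /=; rewrite mul0r addr0. Qed.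

Lemma csmooth_coord_mul (R : realType) (p : nat) (l : 'I_p)
    (f : 'rV[R]_p -> R[i]) :
  csmooth f -> csmooth (fun x : 'rV[R]_p => (x 0 l)%:C * f x).
Proof.
by move=> [fr fi]; rewrite /csmooth Re_coord_mul Im_coord_mul; split;
  exact: smooth_real_coord_mul.
Qed.

Lemma cpartial_coord_mul (R : realType) (p : nat) (k l : 'I_p)
    (f : 'rV[R]_p -> R[i]) : csmooth f ->
  cpartial k (fun x : 'rV[R]_p => (x 0 l)%:C * f x)
  = fun x => (x 0 l)%:C * cpartial k f x + (l == k)%:R * f x.
Proof.
move=> [fr fi]; apply/funext => x; rewrite /cpartial Re_coord_mul Im_coord_mul.
rewrite (partial_real_coord_mul k l fr) (partial_real_coord_mul k l fi).
case: (f x) => u v; case: (l == k) => /=; apply/eqP; rewrite eq_complex /=;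
  by apply/andP; split; apply/eqP; ring.
Qed.

Section SmoothFields.
Variables (R : realType) (p d : nat).
Implicit Types phi psi : 'rV[R]_p -> 'cV[R[i]]_d.

Lemma partial_entry (k : 'I_p) phi (j : 'I_d) :
  (fun x => partial k phi x j 0) = cpartial k (fun x => phi x j 0).
Proof. by apply/funext => x; rewrite mxE. Qed.

Lemma partial_ext (k : 'I_p) phi psi :
  (forall j, cpartial k (fun x => phi x j 0) = fun x => psi x j 0) ->
  partial k phi = psi.
Proof.
move=> E; apply/funext => x; apply/colP => j.
by rewrite -[RHS]/((fun x => psi x j 0) x) -E -partial_entry.
Qed.

Lemma smooth_partial (k : 'I_p) phi : smooth phi -> smooth (partial k phi).
Proof.
move=> sphi j.
suff : csmooth (fun x => partial k phi x j 0) by [].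
by rewrite partial_entry; apply: csmooth_cpartial; exact: sphi.
Qed.

Lemma partialC (k l : 'I_p) phi :
  smooth phi -> partial k (partial l phi) = partial l (partial k phi).
Proof.
move=> sphi; apply: partial_ext => j.
by rewrite !partial_entry cpartialC //; exact: sphi.
Qed.

Lemma smoothD phi psi : smooth phi -> smooth psi ->
  smooth (fun x => phi x + psi x).
Proof.
move=> sphi spsi j; suff : csmooth (fun x => (phi x + psi x) j 0) by [].
have -> : (fun x => (phi x + psi x) j 0) = fun x => phi x j 0 + psi x j 0.
  by apply/funext => x; rewrite mxE.
by apply: csmoothD; [exact: sphi|exact: spsi].
Qed.

Lemma partialD (k : 'I_p) phi psi : smooth phi -> smooth psi ->
  partial k (fun x => phi x + psi x) = fun x => partial k phi x + partial k psi x.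
Proof.
move=> sphi spsi; apply: partial_ext => j.
have -> : (fun x => (phi x + psi x) j 0) = fun x => phi x j 0 + psi x j 0.
  by apply/funext => x; rewrite mxE.
rewrite (cpartialD k (sphi j) (spsi j)) -!partial_entry.
by apply/funext => x; rewrite [RHS]mxE.
Qed.

Lemma smooth_mulmx (A : 'M[R[i]]_d) phi : smooth phi ->
  smooth (fun x => A *m phi x).
Proof.
move=> sphi j; suff : csmooth (fun x => (A *m phi x) j 0) by [].
have -> : (fun x => (A *m phi x) j 0) = fun x => \sum_l A j l * phi x l 0.
  by apply/funext => x; rewrite mxE.
by apply: csmooth_sum => l; apply: csmoothZ; exact: sphi.
Qed.

Lemma partial_mulmx (k : 'I_p) (A : 'M[R[i]]_d) phi : smooth phi ->
  partial k (fun x => A *m phi x) = fun x => A *m partial k phi x.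
Proof.
move=> sphi; apply: partial_ext => j.
have -> : (fun x => (A *m phi x) j 0) = fun x => \sum_l A j l * phi x l 0.
  by apply/funext => x; rewrite mxE.
rewrite cpartial_sum; last by move=> l; apply: csmoothZ; exact: sphi.
apply/funext => x; rewrite mxE; apply: eq_bigr => l _.
by rewrite (cpartialZ k _ (sphi l)) -partial_entry.
Qed.

Lemma smooth_coord_mul (l : 'I_p) phi : smooth phi ->
  smooth (fun x : 'rV[R]_p => (x 0 l)%:C *: phi x).
Proof.
move=> sphi j; suff : csmooth (fun x : 'rV[R]_p => ((x 0 l)%:C *: phi x) j 0) by [].
have -> : (fun x : 'rV[R]_p => ((x 0 l)%:C *: phi x) j 0) = fun x => (x 0 l)%:C * phi x j 0.
  by apply/funext => x; rewrite mxE.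
by apply: csmooth_coord_mul; exact: sphi.
Qed.

Lemma partial_coord_mul (k l : 'I_p) phi : smooth phi ->
  partial k (fun x : 'rV[R]_p => (x 0 l)%:C *: phi x)
  = fun x => (x 0 l)%:C *: partial k phi x + (l == k)%:R *: phi x.
Proof.
move=> sphi; apply: partial_ext => j.
have -> : (fun x : 'rV[R]_p => ((x 0 l)%:C *: phi x) j 0) = fun x => (x 0 l)%:C * phi x j 0.
  by apply/funext => x; rewrite mxE.
rewrite (cpartial_coord_mul k l (sphi j)) -partial_entry.
by apply/funext => x; rewrite !mxE.
Qed.

End SmoothFields.

(** * The coefficients and their three-term recurrence *)

Section Coefficients.
Variables (K : numFieldType) (w : K).

Definition bs_prod (M j : nat) : K :=
  \prod_(0 <= v < M | odd v || (j <= v)%N) (w + v%:R).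

Definition bs_den (j : nat) : nat := (2 ^ j./2 * (j./2)`!)%N.

(** The coefficient of T^j iota d_n^(M-j) in the M-fold product.  The falling
    factorial vanishes for j > M, so sums over j may run past M. *)
Definition bs_coef (M j : nat) : K :=
  (-1) ^+ (M + j) * (M ^_ j)%:R / (bs_den j)%:R * bs_prod M j.

Lemma bs_prodS (M j : nat) :
  bs_prod M.+1 j = bs_prod M j * (if odd M || (j <= M)%N then w + M%:R else 1).
Proof. by rewrite /bs_prod big_mkcond big_nat_recr //= -big_mkcond. Qed.

(** Passing from j+1 to j adds a factor for even j only, while [bs_den] grows
    from j to j+1 for odd j only; hence the recurrence is checked separately for
    the two parities. *)
Lemma bs_prod_odd (M j : nat) : odd j -> bs_prod M j = bs_prod M j.+1.
Proof.
move=> oj; apply: eq_bigl => v; case: (ltngtP j v) => [||<-]; rewrite ?oj //.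
Qed.

Lemma bs_prod_even (M j : nat) : ~~ odd j -> (j < M)%N ->
  bs_prod M j = (w + j%:R) * bs_prod M j.+1.
Proof.
move=> oj; elim: M => // M IHM; rewrite ltnS leq_eqVlt => /predU1P[jM|jM].
  rewrite -jM !bs_prodS leqnn orbT ltnn (negbTE oj) mulr1 mulrC; congr (_ * _).
  by apply: congr_big_nat => // v /andP [_ vM]; rewrite leqNgt vM ltnNge ltnW.
by rewrite !bs_prodS IHM // jM ltnW // mulrA.
Qed.

Lemma bs_den_neq0 (j : nat) : (bs_den j)%:R != 0 :> K.
Proof. by rewrite pnatr_eq0 -lt0n muln_gt0 expn_gt0 fact_gt0. Qed.

Lemma bs_den_odd (j : nat) : ~~ odd j -> bs_den j.+1 = bs_den j.
Proof. by rewrite /bs_den /= uphalf_half => /negbTE ->. Qed.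

Lemma bs_den_even (j : nat) : odd j -> bs_den j.+1 = (j.+1 * bs_den j)%N.
Proof.
move=> oj; rewrite /bs_den /= uphalf_half oj add1n expnS factS.
have -> : j.+1 = (2 * (j./2).+1)%N by rewrite -{1}(odd_double_half j) oj; lia.
by lia.
Qed.

Lemma bs_coef_out (M j : nat) : (M < j)%N -> bs_coef M j = 0.
Proof. by move=> Mj; rewrite /bs_coef ffact_small // mulr0 !mul0r. Qed.

Lemma bs_coefS0 (M : nat) : bs_coef M.+1 0 = - (w + M%:R) * bs_coef M 0.
Proof.
rewrite /bs_coef bs_prodS leq0n orbT !ffactn0 !addn0 exprS; field.
exact: bs_den_neq0.
Qed.

Lemma bs_coefS1 (M : nat) :
  bs_coef M.+1 1 = - (w + M%:R + 1) * bs_coef M 1 + bs_coef M 0.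
Proof.
rewrite /bs_coef !ffactn1 ffactn0 addn0 !addn1 !exprS bs_den_odd //.
have d0 := bs_den_neq0 0; case: M => [|M].
  by rewrite bs_prodS /= /bs_prod !big_geq // expr0; field.
by rewrite bs_prodS orbT (@bs_prod_even _ 0) // [M.+2%:R]mulrSr; field.
Qed.

(** Up to common factors this is the polynomial identity
      (m + 1)(w + m) = (w + m + j)(m - j + 1) + j + j (w + j - 2)
    for even j, and
      (m + 1)(w + m) = (w + m + j)(m - j + 1) + j (w + j - 1)
    for odd j, where j stands for the index j + 2 of the statement. *)
Lemma bs_coefSS (M j : nat) : (j < M)%N ->
  bs_coef M.+1 j.+2 = - (w + M%:R + j.+2%:R) * bs_coef M j.+2 + bs_coef M j.+1
                      - (M - j)%:R * bs_coef M j.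
Proof.
move=> jM; rewrite /bs_coef ffactSS !ffactnSr [(M.+1 * _)%:R]natrM.
rewrite [(_ * (M - j.+1))%:R]natrM ![(_ * (M - j))%:R]natrM !addSn !addnS !exprS.
have := bs_den_neq0 j; have : j%:R + 1 != 0 :> K by rewrite natr1 pnatr_eq0.
have : j%:R + 1 + 1 != 0 :> K by rewrite !natr1 pnatr_eq0.
rewrite [(M - j.+1)%:R]natrB // natrB ?(ltnW jM) // -[M.+1%:R]natr1.
case: (boolP (odd j)) => oj; last first.
  rewrite (@bs_den_even j.+1) // (@bs_den_odd j) // natrM (@bs_prod_even _ j) //.
  rewrite (@bs_prod_odd _ j.+1) // bs_prodS.
  have -> : odd M || (j.+2 <= M)%N.
    by move: jM; rewrite leq_eqVlt => /predU1P[<-|->]; rewrite /= ?oj ?orbT.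
  rewrite -[j.+2%:R]natr1 -[j.+1%:R]natr1.
  move: ((-1) ^+ _) (bs_den j)%:R (M ^_ j)%:R (bs_prod M _) M%:R j%:R => s d a q x y.
  by move=> y2 y1 d0; field; rewrite d0 y2.
rewrite (@bs_den_odd j.+1) /= ?oj // (@bs_den_even j) // natrM (@bs_prod_odd _ j) //.
rewrite bs_prodS; move: (jM); rewrite leq_eqVlt => /predU1P[jM1|jM1].
  (* Here M is even and below j + 2, so w + M does not enter on the left. *)
  rewrite -[in if _ then _ else _]jM1 ltnn /= oj /=.
  have -> : bs_prod M j.+1 = bs_prod M j.+2.
    by apply: congr_big_nat => // v /andP [_ vM]; congr (_ || _); lia.
  have -> : M%:R = j%:R + 1 :> K by rewrite natr1 jM1.
  rewrite -[j.+2%:R]natr1 -[j.+1%:R]natr1.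
  move: ((-1) ^+ _) (bs_den j)%:R (M ^_ j)%:R (bs_prod M _) j%:R => s d a q y.
  by move=> y2 y1 d0; field; rewrite d0 y1.
rewrite jM1 orbT (@bs_prod_even _ j.+1) /= ?oj //.
rewrite -[j.+2%:R]natr1 -[j.+1%:R]natr1.
move: ((-1) ^+ _) (bs_den j)%:R (M ^_ j)%:R (bs_prod M _) M%:R j%:R => s d a q x y.
by move=> y2 y1 d0; field; rewrite d0 y1.
Qed.

End Coefficients.

(** * Iterated products in the Weyl algebra *)

Section WeylExpansion.
Variables (K : numFieldType) (V W : lmodType K).
Variables (D X T : {linear V -> V}) (rho : {linear V -> W}).
Hypothesis DX : forall phi, D (X phi) = X (D phi) + phi.
Hypothesis TX : forall phi, T (X phi) = X (T phi).
Hypothesis DT : forall phi, D (T phi) = T (D phi).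
Hypothesis rhoX : forall phi, rho (X phi) = 0.

Definition weyl_step (c : K) (phi : V) : V :=
  c *: D phi + T phi + X (D (D phi) - T (T phi)).

Fixpoint weyl_iter (N : nat) (c : K) (phi : V) : V :=
  if N is N'.+1 then weyl_step (c + 2 * N'%:R) (weyl_iter N' c phi) else phi.

(** The definition peels off the factor that acts last; the expansion below
    proceeds by the factor that acts first. *)
Lemma weyl_iterSr (N : nat) (c : K) (phi : V) :
  weyl_iter N.+1 c phi = weyl_iter N (c + 2) (weyl_step c phi).
Proof.
elim: N => [|N IHN]; first by rewrite /= mulr0 addr0.
rewrite -[LHS]/(weyl_step _ (weyl_iter N.+1 c phi)) IHN /=.
by congr (weyl_step _ _); rewrite -[N.+1%:R]natr1; ring.
Qed.

(** Each commutation of D with X contributes one copy of D^2 - T^2; the m copies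
    of D^2 change the coefficient c into c + m.  For m = 0 the truncated
    predecessor is harmless because its coefficient is 0. *)
Lemma iter_D_step (m : nat) (c : K) (phi : V) :
  iter m D (weyl_step c phi)
  = (c + m%:R) *: iter m.+1 D phi + T (iter m D phi)
    - m%:R *: T (T (iter m.-1 D phi))
    + X (iter m.+2 D phi - T (T (iter m D phi))).
Proof.
elim: m => [|m IHm]; first by rewrite addr0 scale0r subr0.
have Dadd a b : D (a + b) = D a + D b by rewrite linearD.
have Dopp a : D (- a) = - D a by rewrite linearN.
have Dscale s a : D (s *: a) = s *: D a by rewrite linearZ.
rewrite iterS IHm /= !(Dadd, Dopp, Dscale, DX, DT).
have -> : m%:R *: T (T (D (iter m.-1 D phi))) = m%:R *: T (T (iter m D phi)).
  by case: m {IHm} => [|m] //; rewrite !scale0r.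
rewrite -[m.+1%:R]natr1 !scalerDl !scale1r opprD.
set a := c *: _; set b := m%:R *: _; set e := D (D (iter m D phi)).
set f := T (D _); set g := T (T _); set h := m%:R *: _; set x := X _.
rewrite [x + _]addrC !addrA; congr (_ + x).
by congr (_ + _); rewrite [LHS]addrAC; congr (_ + _); rewrite [LHS]addrAC.
Qed.

Lemma rho_step (j m : nat) (c : K) (phi : V) :
  rho (iter j T (iter m D (weyl_step c phi)))
  = (c + m%:R) *: rho (iter j T (iter m.+1 D phi))
    + rho (iter j.+1 T (iter m D phi))
    - m%:R *: rho (iter j.+2 T (iter m.-1 D phi)).
Proof.
have TjD i (a b : V) : iter i T (a + b) = iter i T a + iter i T b.
  by elim: i => //= i ->; rewrite linearD.
have TjZ i s (a : V) : iter i T (s *: a) = s *: iter i T a.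
  by elim: i => //= i ->; rewrite linearZ.
have TjX i (a : V) : iter i T (X a) = X (iter i T a).
  by elim: i => //= i ->; rewrite TX.
rewrite iter_D_step -scaleNr !TjD !TjZ TjX !linearD rhoX addr0 !linearZ /=.
by rewrite scaleNr scalerN -!iterSr.
Qed.

Lemma rho_weyl_iter (M : nat) (c : K) (phi : V) :
  rho (weyl_iter M c phi)
  = \sum_(j < M.+1) bs_coef (2 - c - 2 * M%:R) M j
                      *: rho (iter j T (iter (M - j) D phi)).
Proof.
elim: M c phi => [|M IHM] c phi.
  rewrite big_ord1 /= /bs_coef /bs_prod big_geq // ffactn0 /bs_den /= expr0.
  by rewrite !mul1r !mulr1 invr1 scale1r.
rewrite weyl_iterSr IHM; set w := 2 - c - 2 * M.+1%:R.
have -> : 2 - (c + 2) - 2 * M%:R = w by rewrite /w -natr1; ring.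
pose u i := rho (iter i T (iter (M.+1 - i) D phi)).
pose A i := bs_coef w M i * (c + (M - i)%:R).
pose C i := bs_coef w M i * (M - i)%:R.
(* Expand each D^(M-j) applied to the first factor, then collect u_j, u_(j+1)
   and u_(j+2) by shifting the index. *)
transitivity (\sum_(j < M.+1)
    (A j *: u j + bs_coef w M j *: u j.+1 - C j *: u j.+2)).
  apply: eq_bigr => j _; rewrite rho_step !(scalerDr, scalerN) !scalerA.
  by rewrite /u !subSS subnS subSn // -ltnS.
rewrite !big_split /= sumrN.
have -> : \sum_(j < M.+1) A j *: u j = \sum_(j < M.+2) A j *: u j.
  by rewrite [RHS]big_ord_recr /= /A bs_coef_out // mul0r scale0r addr0.
have -> : \sum_(j < M.+1) bs_coef w M j *: u j.+1
    = \sum_(j < M.+2) (if val j is i.+1 then bs_coef w M i else 0) *: u j.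
  by rewrite [RHS]big_ord_recl /= scale0r add0r.
have -> : \sum_(j < M.+1) C j *: u j.+2
    = \sum_(j < M.+2) (if val j is i.+2 then C i else 0) *: u j.
  have CM : C M = 0 by rewrite /C subnn mulr0.
  rewrite big_ord_recr /= CM scale0r addr0.
  by rewrite [RHS]big_ord_recl /= big_ord_recl /= !scale0r !add0r.
rewrite -sumrN -!big_split /=; apply: eq_bigr => j _.
rewrite -scaleNr -!scalerDl; congr (_ *: _).
have cE : c = - w - 2 * M%:R by rewrite /w -natr1; ring.
case: j => -[|[|j]] /= jM.
- by rewrite bs_coefS0 /A subn0 cE; ring.
- rewrite bs_coefS1 subr0 /A cE; case: (M) => [|M'].
    by rewrite [bs_coef w 0 1]bs_coef_out //; ring.
  by rewrite subSS subn0 -natr1; ring.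
rewrite bs_coefSS; last by lia.
rewrite /A /C cE.
case: (ltnP M j.+2) => Mj.
  by rewrite [bs_coef w M j.+2]bs_coef_out //; ring.
by rewrite !natrB //; [rewrite -!natr1; ring|lia].
Qed.

End WeylExpansion.

(** * The coefficients in terms of Pochhammer symbols and double factorials *)

Section ClosedForms.
Variables (K : numFieldType) (w : K).

Lemma bs_prod_double (N k : nat) :
  bs_prod w (2 * N) (2 * k)
  = \prod_(0 <= i < N) (w + 2 * i%:R + 1) * \prod_(k <= i < N) (w + 2 * i%:R).
Proof.
elim: N => [|N IHN]; first by rewrite /bs_prod !big_geq // mulr1.
rewrite mulnS !bs_prodS IHN /= oddM /= leq_pmul2l // big_nat_recr //=.
rewrite -[(2 * N).+1%:R]natr1 [(2 * N)%:R]natrM.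
case: leqP => kN; first by rewrite big_nat_recr //=; ring.
have kN' : (N <= k)%N by rewrite ltnW.
by rewrite ![\prod_(k <= i < _) _]big_geq //; ring.
Qed.

Lemma pochhammer_double (N : nat) (a : K) :
  2 ^+ N * pochhammer a N = \prod_(0 <= i < N) (2 * a + 2 * i%:R).
Proof.
rewrite /pochhammer big_mkord -[N in 2 ^+ N]card_ord -prodr_const -big_split /=.
by apply: eq_bigr => i _; rewrite mulrDr.
Qed.

End ClosedForms.

Lemma dfact_odd (N : nat) : (dfact (2 * N + 1) * (2 ^ N * N`!) = (2 * N + 1)`!)%N.
Proof.
elim: N => // N IHN.
have -> : (2 * N.+1 + 1 = (2 * N + 1).+2)%N by lia.
rewrite [dfact _]/= !factS -IHN expnS.
move: (dfact _) (2 ^ N)%N (N`!) => a b c; lia.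
Qed.

Lemma dfact_even (N : nat) : (dfact (2 * N - 1) * (2 ^ N * N`!) = (2 * N)`!)%N.
Proof.
case: N => // N; have -> : (2 * N.+1 - 1 = 2 * N + 1)%N by lia.
have -> : (2 * N.+1 = (2 * N + 1).+1)%N by lia.
rewrite [(2 * N + 1).+1`!]factS -dfact_odd expnS factS.
move: (dfact _) (2 ^ N)%N (N`!) => a b c; lia.
Qed.

Section Matching.
Variables (R : realType) (m : nat).
Implicit Types lambda : R[i].
Local Notation n := (m.+1%:R : R[i]).

Lemma coef_a_prod (N k : nat) lambda :
  coef_a m N k (- (n - lambda + 2^-1))
  = (- 2) ^+ (N - k) * N`!%:R / (k`!%:R * (2 * N - 2 * k)`!%:R)
    * \prod_(k <= i < N) (2 * lambda - n - 4 * N%:R + 2 * i%:R).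
Proof.
by rewrite /coef_a; congr (_ * _); apply: eq_bigr => i _; field.
Qed.

Lemma coef_b_prod (N k : nat) lambda :
  coef_b m N k (- (n - lambda + 2^-1))
  = (- 2) ^+ (N - k) * N`!%:R / (k`!%:R * (2 * N - 2 * k + 1)`!%:R)
    * \prod_(k <= i < N) (2 * lambda - n - 4 * N%:R - 2 + 2 * i%:R).
Proof.
by rewrite /coef_b; congr (_ * _); apply: eq_bigr => i _; field.
Qed.

Lemma natr_ffact (M j : nat) : (j <= M)%N ->
  (M ^_ j)%:R = M`!%:R / (M - j)`!%:R :> R[i].
Proof.
move=> jM; apply: (canRL (mulfK _)); first by rewrite pnatr_eq0 -lt0n fact_gt0.
by rewrite -natrM ffact_fact.
Qed.

Lemma bs_den_double (k : nat) : bs_den (2 * k) = (2 ^ k * k`!)%N.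
Proof. by rewrite /bs_den mul2n doubleK. Qed.

Lemma bs_den_doubleS (k : nat) : bs_den (2 * k).+1 = (2 ^ k * k`!)%N.
Proof. by rewrite bs_den_odd ?bs_den_double // oddM. Qed.

Lemma natr_fact_neq0 (k : nat) : (k`!)%:R != 0 :> R[i].
Proof. by rewrite pnatr_eq0 -lt0n fact_gt0. Qed.

Lemma exprN2 (k : nat) : (- 2) ^+ k = (-1) ^+ k * 2 ^+ k :> R[i].
Proof. by rewrite -exprMn mulN1r. Qed.

Lemma exp2_neq0 (k : nat) : 2 ^+ k != 0 :> R[i].
Proof. by rewrite expf_neq0 // pnatr_eq0. Qed.

Lemma sign_cases (k : nat) : {(-1) ^+ k = 1 :> R[i]} + {(-1) ^+ k = -1 :> R[i]}.
Proof. by rewrite -signr_odd; case: odd; [right|left]. Qed.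

(** In the four cases below w specialises to 2 lambda - n - 2 M, the odd factors
    of [bs_prod] give the Pochhammer symbol, and the even factors give the
    products of a and b.  The sign (-1)^k comes from T^(2k) = (-1)^k Delta'^k. *)
Lemma bs_coef_even_even (N k : nat) lambda : (k <= N)%N ->
  bs_coef (2 * lambda - n - 4 * N%:R) (2 * N) (2 * k)
  = (- 2) ^+ N * pochhammer (lambda - n / 2 - 2 * N%:R + 1 / 2) N
     * (dfact (2 * N - 1))%:R
    * (coef_a m N k (- (n - lambda + 2^-1)) * (-1) ^+ k).
Proof.
move=> kN; rewrite coef_a_prod /bs_coef bs_prod_double bs_den_double.
rewrite exprN2 -[_ * 2 ^+ N * _]mulrA pochhammer_double.
rewrite natr_ffact ?leq_pmul2l // -dfact_even -mulnDr exprM sqrrN expr1n expr1n.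
rewrite !natrM !natrX exprN2.
have -> : \prod_(0 <= i < N) (2 * (lambda - n / 2 - 2 * N%:R + 1 / 2) + 2 * i%:R)
  = \prod_(0 <= i < N) (2 * lambda - n - 4 * N%:R + 2 * i%:R + 1).
  by apply: eq_bigr => i _; field.
have -> : (-1) ^+ N = (-1) ^+ (N - k) * (-1) ^+ k :> R[i] by rewrite -exprD subnK.
have -> : 2 ^+ N = 2 ^+ (N - k) * 2 ^+ k :> R[i] by rewrite -exprD subnK.
have d1 := natr_fact_neq0 k; have d2 := natr_fact_neq0 (2 * N - 2 * k).
have d3 := exp2_neq0 k.
by case: (sign_cases k) => ->; case: (sign_cases (N - k)) => ->;
  field; rewrite d1 d2 d3.
Qed.

Lemma bs_coef_even_odd (N k : nat) lambda : (k <= N)%N ->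
  bs_coef (2 * lambda - n - 4 * N.+1%:R) (2 * N.+1) (2 * k).+1
  = (- 2) ^+ N.+1 * pochhammer (lambda - n / 2 - 2 * N.+1%:R + 1 / 2) N.+1
     * (dfact (2 * N.+1 - 1))%:R
    * (2 * N.+1%:R * (coef_b m N k (- (n - lambda + 2^-1)) * (-1) ^+ k)).
Proof.
move=> kN; rewrite coef_b_prod /bs_coef bs_prod_odd ?bs_den_doubleS /= ?oddM //.
rewrite -[(2 * k).+2]/((2 + 2 * k)%N) -mulnS bs_prod_double big_add1.
rewrite exprN2 -[_ * 2 ^+ N.+1 * _]mulrA pochhammer_double.
rewrite natr_ffact; last by lia.
rewrite -dfact_even addnS -mulnDr exprS exprM sqrrN expr1n expr1n.
have -> : (2 * N.+1 - (2 * k).+1 = 2 * N - 2 * k + 1)%N by lia.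
rewrite factS !natrM !natrX exprN2.
have -> : \prod_(0 <= i < N.+1)
    (2 * (lambda - n / 2 - 2 * N.+1%:R + 1 / 2) + 2 * i%:R)
  = \prod_(0 <= i < N.+1) (2 * lambda - n - 4 * N.+1%:R + 2 * i%:R + 1).
  by apply: eq_bigr => i _; field.
have -> : \prod_(k <= i < N.+1.-1) (2 * lambda - n - 4 * N.+1%:R + 2 * i.+1%:R)
  = \prod_(k <= i < N) (2 * lambda - n - 4 * N%:R - 2 + 2 * i%:R).
  by apply: eq_bigr => i _; rewrite -!natr1; ring.
have -> : (-1) ^+ N.+1 = - ((-1) ^+ (N - k) * (-1) ^+ k) :> R[i].
  by rewrite exprS mulN1r -exprD subnK.
have -> : 2 ^+ N.+1 = 2 * (2 ^+ (N - k) * 2 ^+ k) :> R[i].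
  by rewrite exprS -exprD subnK.
have d1 := natr_fact_neq0 k; have d2 := natr_fact_neq0 (2 * N - 2 * k + 1).
have d3 := exp2_neq0 k.
by case: (sign_cases k) => ->; case: (sign_cases (N - k)) => ->;
  field; rewrite d1 d2 d3.
Qed.

(** For odd M the last even factor w + 2N lies outside the product of b; it is
    the opposite of the scalar 2 (n - lambda) - n + 2N + 2 in front of D_(2N+1). *)
Lemma bs_coef_odd_even (N k : nat) lambda : (k <= N)%N ->
  bs_coef (2 * lambda - n - 4 * N%:R - 2) (2 * N).+1 (2 * k)
  = (- 2) ^+ N * pochhammer (lambda - n / 2 - 2 * N%:R - 1 / 2) N
     * (dfact (2 * N + 1))%:R
    * ((2 * (n - lambda) - n + 2 * N%:R + 2) *
       (coef_b m N k (- (n - lambda + 2^-1)) * (-1) ^+ k)).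
Proof.
move=> kN; rewrite coef_b_prod /bs_coef bs_prodS bs_prod_double bs_den_double.
rewrite leq_pmul2l // kN orbT [(2 * N)%:R]natrM.
rewrite exprN2 -[_ * 2 ^+ N * _]mulrA pochhammer_double.
rewrite natr_ffact; last by lia.
rewrite -[(2 * N).+1]addn1 -dfact_odd addnAC -mulnDr addn1 exprS exprM sqrrN expr1n expr1n.
have -> : (2 * N + 1 - 2 * k = 2 * N - 2 * k + 1)%N by lia.
rewrite !natrM !natrX exprN2.
have -> : \prod_(0 <= i < N) (2 * (lambda - n / 2 - 2 * N%:R - 1 / 2) + 2 * i%:R)
  = \prod_(0 <= i < N) (2 * lambda - n - 4 * N%:R - 2 + 2 * i%:R + 1).
  by apply: eq_bigr => i _; field.
have -> : (-1) ^+ N = (-1) ^+ (N - k) * (-1) ^+ k :> R[i] by rewrite -exprD subnK.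
have -> : 2 ^+ N = 2 ^+ (N - k) * 2 ^+ k :> R[i] by rewrite -exprD subnK.
have d1 := natr_fact_neq0 k; have d2 := natr_fact_neq0 (2 * N - 2 * k + 1).
have d3 := exp2_neq0 k.
by case: (sign_cases k) => ->; case: (sign_cases (N - k)) => ->;
  field; rewrite d1 d2 d3.
Qed.

Lemma bs_coef_odd_odd (N k : nat) lambda : (k <= N)%N ->
  bs_coef (2 * lambda - n - 4 * N%:R - 2) (2 * N).+1 (2 * k).+1
  = (- 2) ^+ N * pochhammer (lambda - n / 2 - 2 * N%:R - 1 / 2) N
     * (dfact (2 * N + 1))%:R
    * (coef_a m N k (- (n - lambda + 2^-1)) * (-1) ^+ k).
Proof.
move=> kN; rewrite coef_a_prod /bs_coef bs_prod_odd ?bs_den_doubleS /= ?oddM //.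
rewrite bs_prodS -[(2 * k).+2]/((2 + 2 * k)%N) -mulnS bs_prod_double.
rewrite leq_pmul2l // oddM /= [(2 * N)%:R]natrM.
rewrite exprN2 -[_ * 2 ^+ N * _]mulrA pochhammer_double.
rewrite natr_ffact; last by lia.
have -> : ((2 * N).+1 - (2 * k).+1 = 2 * N - 2 * k)%N by lia.
rewrite -[(2 * N).+1]addn1 -dfact_odd addnS addn1 addSn -mulnDr !exprS.
rewrite exprM sqrrN expr1n expr1n !natrM !natrX exprN2.
have -> : \prod_(0 <= i < N) (2 * (lambda - n / 2 - 2 * N%:R - 1 / 2) + 2 * i%:R)
  = \prod_(0 <= i < N) (2 * lambda - n - 4 * N%:R - 2 + 2 * i%:R + 1).
  by apply: eq_bigr => i _; field.
have -> : \prod_(k <= i < N) (2 * lambda - n - 4 * N%:R + 2 * i%:R)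
  = \prod_(k.+1 <= i < N) (2 * lambda - n - 4 * N%:R - 2 + 2 * i%:R)
    * (if (k < N)%N then 2 * lambda - n - 4 * N%:R - 2 + 2 * N%:R else 1).
  transitivity (\prod_(k.+1 <= i < N.+1) (2 * lambda - n - 4 * N%:R - 2 + 2 * i%:R)).
    by rewrite big_add1 /=; apply: eq_bigr => i _; rewrite -natr1; ring.
  by case: ltnP => kN'; [rewrite big_nat_recr|rewrite !big_geq ?mulr1 // leqW].
have -> : (-1) ^+ N = (-1) ^+ (N - k) * (-1) ^+ k :> R[i] by rewrite -exprD subnK.
have -> : 2 ^+ N = 2 ^+ (N - k) * 2 ^+ k :> R[i] by rewrite -exprD subnK.
have d1 := natr_fact_neq0 k; have d2 := natr_fact_neq0 (2 * N - 2 * k).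
have d3 := exp2_neq0 k.
move: (if _ then _ else _) => q.
by case: (sign_cases k) => ->; case: (sign_cases (N - k)) => ->;
  field; rewrite d1 d2 d3.
Qed.

End Matching.

(** * The module of smooth fields *)

Section SmoothModule.
Variables (R : realType) (p d : nat).
Local Notation field := ('rV[R]_p -> 'cV[R[i]]_d).

(** A boolean version of smoothness, in order to form a subtype that inherits
    the pointwise module structure of fields. *)
Definition smooth_pred : {pred field} := fun phi => `[< smooth phi >].

Lemma smooth_submod : submod_closed smooth_pred.
Proof.
split=> [|a phi psi /asboolP sphi /asboolP spsi]; apply/asboolP.
  move=> j; suff : csmooth (fun x => (0 : field) x j 0) by [].
  have -> : (fun x => (0 : field) x j 0) = fun=> 0.
    by apply/funext => x; rewrite mxE.
  by split; exact: smooth_real0.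
have := smoothD (smooth_mulmx a%:M sphi) spsi.
by under eq_fun do rewrite mul_scalar_mx.
Qed.

HB.instance Definition _ :=
  GRing.isSubmodClosed.Build _ _ smooth_pred smooth_submod.

Record sfield := SField { sfield_val :> field; _ : sfield_val \in smooth_pred }.

HB.instance Definition _ := [isSub for sfield_val].
HB.instance Definition _ := [Choice of sfield by <:].
HB.instance Definition _ := [SubChoice_isSubLmodule of sfield by <:].

Lemma smooth_sfield (f : sfield) : smooth f.
Proof. by apply/asboolP; case: f. Qed.

Definition mk_sfield (phi : field) (sphi : smooth phi) : sfield :=
  SField (introT (asboolP _) sphi).

Lemma sfield_inj (f g : sfield) : (forall x, f x = g x) -> f = g.
Proof. by move=> fg; apply: val_inj; apply/funext. Qed.

Lemma sfieldD (f g : sfield) x : (f + g) x = f x + g x. Proof. by []. Qed.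
Lemma sfieldN (f : sfield) x : (- f) x = - f x. Proof. by []. Qed.
Lemma sfieldZ a (f : sfield) x : (a *: f) x = a *: f x. Proof. by []. Qed.
Lemma sfield_sum (I : Type) (r : seq I) (F : I -> sfield) x :
  (\sum_(i <- r) F i) x = \sum_(i <- r) F i x.
Proof.
elim: r => [|i r IHr]; first by rewrite !big_nil.
by rewrite !big_cons sfieldD IHr.
Qed.

Definition spartial (k : 'I_p) (f : sfield) : sfield :=
  mk_sfield (smooth_partial k (smooth_sfield f)).
Definition smul (A : 'M[R[i]]_d) (f : sfield) : sfield :=
  mk_sfield (smooth_mulmx A (smooth_sfield f)).
Definition scoord (l : 'I_p) (f : sfield) : sfield :=
  mk_sfield (smooth_coord_mul l (smooth_sfield f)).

Lemma smul_linear A : linear (smul A).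
Proof.
by move=> a f g; apply: sfield_inj => x; rewrite /= mulmxDr -scalemxAr.
Qed.
HB.instance Definition _ A :=
  GRing.isLinear.Build R[i] sfield sfield *:%R (smul A) (smul_linear A).

Lemma scoord_linear l : linear (scoord l).
Proof.
by move=> a f g; apply: sfield_inj => x; 
  rewrite -[LHS]/((x 0 l)%:C *: (a *: f x + g x)) scalerDr !scalerA mulrC -scalerA.
Qed.
HB.instance Definition _ l :=
  GRing.isLinear.Build R[i] sfield sfield *:%R (scoord l) (scoord_linear l).

Lemma smul_scalar a f : smul a%:M f = a *: f.
Proof. by apply: sfield_inj => x; rewrite /= mul_scalar_mx. Qed.

Lemma smulM A B f : smul A (smul B f) = smul (A *m B) f.
Proof. by apply: sfield_inj => x; rewrite /= mulmxA. Qed.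

Lemma smulDl A B f : smul A f + smul B f = smul (A + B) f.
Proof. by apply: sfield_inj => x; rewrite /= mulmxDl. Qed.

Lemma smulN A f : smul (- A) f = - smul A f.
Proof. by apply: sfield_inj => x; rewrite /= mulNmx. Qed.

Lemma smul_scoord A l f : smul A (scoord l f) = scoord l (smul A f).
Proof. by apply: sfield_inj => x; rewrite /= -scalemxAr. Qed.

Lemma spartial_smul k A f : spartial k (smul A f) = smul A (spartial k f).
Proof.
by apply: sfield_inj => x; rewrite /= (partial_mulmx k A (smooth_sfield f)).
Qed.

Lemma spartial_linear k : linear (spartial k).
Proof.
move=> a f g; rewrite -!smul_scalar -spartial_smul.
apply: sfield_inj => x /=.
by rewrite (partialD k (smooth_sfield (smul a%:M f)) (smooth_sfield g)).
Qed.
HB.instance Definition _ k :=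
  GRing.isLinear.Build R[i] sfield sfield *:%R (spartial k) (spartial_linear k).

Lemma spartialC k l f : spartial k (spartial l f) = spartial l (spartial k f).
Proof.
by apply: sfield_inj => x; rewrite /= (partialC k l (smooth_sfield f)).
Qed.

Lemma spartial_scoord k l f :
  spartial k (scoord l f) = scoord l (spartial k f) + (l == k)%:R *: f.
Proof.
by apply: sfield_inj => x; rewrite /= (partial_coord_mul k l (smooth_sfield f)).
Qed.

End SmoothModule.

(** * Restriction to the hyperplane *)

Section BoundaryRestriction.
Variables (R : realType) (m d : nat).

Lemma hyperplane_last (y : 'rV[R]_m) : hyperplane y 0 ord_max = 0.
Proof. by rewrite mxE unlift_none. Qed.

Lemma hyperplane_shift (y : 'rV[R]_m) (k : 'I_m) (h : R) :
  hyperplane (h *: delta_mx 0 k + y)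
  = h *: delta_mx 0 (lift ord_max k) + hyperplane y.
Proof.
apply/rowP => j; rewrite !mxE !eqxx /=; case: unliftP => [l|] ->.
  by rewrite !mxE !eqxx /= (inj_eq lift_inj).
by rewrite (negbTE (neq_lift _ _)) mulr0 addr0.
Qed.

(** The two difference quotients coincide, the hyperplane being linearly
    embedded. *)
Lemma partial_real_hyperplane (k : 'I_m) (f : 'rV[R]_m.+1 -> R) (y : 'rV[R]_m) :
  partial_real k (fun z => f (hyperplane z)) y
  = partial_real (lift ord_max k) f (hyperplane y).
Proof.
rewrite /partial_real /derive.
have -> : (fun h : R => h^-1 *: (((fun z => f (hyperplane z)) \o shift y)
     (h *: delta_mx 0 k) - f (hyperplane y)))
  = (fun h : R => h^-1 *: ((f \o shift (hyperplane y))
     (h *: delta_mx 0 (lift ord_max k)) - f (hyperplane y))); last by [].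
by apply/funext => h /=; rewrite hyperplane_shift.
Qed.

Lemma partial_restr (k : 'I_m) (phi : 'rV[R]_m.+1 -> 'cV[R[i]]_d) :
  partial k (restr phi) = restr (partial (lift ord_max k) phi).
Proof.
apply/funext => y; apply/colP => j; rewrite !mxE.
by congr (_ +i* _); exact: partial_real_hyperplane.
Qed.

Definition tlap (f : sfield R m.+1 d) : sfield R m.+1 d :=
  \sum_(k < m) spartial (lift ord_max k) (spartial (lift ord_max k) f).

Lemma iter_laplacian_restr (k : nat) (f : sfield R m.+1 d) :
  iter k (@laplacian R d m) (restr f) = restr (iter k tlap f).
Proof.
elim: k => //= k ->; apply/funext => y.
rewrite /restr /tlap sfield_sum; apply: eq_bigr => l _.
by rewrite -/(restr _) !partial_restr.
Qed.

Lemma tlap_smul (A : 'M[R[i]]_d) (f : sfield R m.+1 d) :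
  tlap (smul A f) = smul A (tlap f).
Proof.
by rewrite /tlap linear_sum; apply: eq_bigr => k _; rewrite !spartial_smul.
Qed.

Lemma tlapN (f : sfield R m.+1 d) : tlap (- f) = - tlap f.
Proof. by rewrite /tlap -sumrN; apply: eq_bigr => k _; rewrite !linearN. Qed.

Local Notation sD := (@spartial R m.+1 d ord_max).

Lemma D_even_sfield (N : nat) (mu : R[i]) (f : sfield R m.+1 d) (y : 'rV[R]_m) :
  D_even N mu f y
  = \sum_(k < N.+1) coef_a m N k (- mu) *:
      iter k tlap (iter (2 * N - 2 * k) sD f) (hyperplane y).
Proof.
apply: eq_bigr => k _; congr (_ *: _).
have -> : iter (2 * N - 2 * k) (@dn R m d) f = iter (2 * N - 2 * k) sD f.
  by elim: (2 * N - 2 * k)%N => //= j ->.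
by rewrite iter_laplacian_restr.
Qed.

Lemma D_odd_sfield (N : nat) (mu : R[i]) (f : sfield R m.+1 d) (y : 'rV[R]_m) :
  D_odd N mu f y
  = \sum_(k < N.+1) coef_b m N k (- mu) *:
      iter k tlap (iter (2 * N - 2 * k + 1) sD f) (hyperplane y).
Proof.
apply: eq_bigr => k _; congr (_ *: _).
have -> : iter (2 * N - 2 * k + 1) (@dn R m d) f = iter (2 * N - 2 * k + 1) sD f.
  by elim: (2 * N - 2 * k + 1)%N => //= j ->.
by rewrite iter_laplacian_restr.
Qed.

Lemma iter_tlap_smul (A : 'M[R[i]]_d) (k j : nat) (f : sfield R m.+1 d) :
  iter k tlap (iter j sD (smul A f)) = smul A (iter k tlap (iter j sD f)).
Proof.
have -> : iter j sD (smul A f) = smul A (iter j sD f).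
  by elim: j => //= j ->; rewrite spartial_smul.
by elim: k => //= k ->; rewrite tlap_smul.
Qed.

Lemma iter_tlap_opp (k j : nat) (f : sfield R m.+1 d) :
  iter k tlap (iter j sD (- f)) = - iter k tlap (iter j sD f).
Proof.
have -> : iter j sD (- f) = - iter j sD f by elim: j => //= j ->; rewrite linearN.
by elim: k => //= k ->; rewrite tlapN.
Qed.

Definition srestr (f : sfield R m.+1 d) : 'rV[R]_m -> 'cV[R[i]]_d := restr f.

Lemma srestr_linear : linear srestr. Proof. by []. Qed.
HB.instance Definition _ :=
  GRing.isLinear.Build R[i] (sfield R m.+1 d) ('rV[R]_m -> 'cV[R[i]]_d) *:%R
    srestr srestr_linear.

Lemma srestr_scoord (f : sfield R m.+1 d) : srestr (scoord ord_max f) = 0.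
Proof.
apply/funext => y.
by rewrite -[LHS]/((hyperplane y 0 ord_max)%:C *: f (hyperplane y))
  hyperplane_last scale0r.
Qed.

End BoundaryRestriction.

(** * The Bernstein-Sato operators in the Weyl algebra *)

Section SpinorOperators.
Variables (R : realType) (m d : nat) (E : 'I_m.+1 -> 'M[R[i]]_d).
Hypothesis hE : clifford_module E.
Local Notation sfield := (sfield R m.+1 d).
Local Notation sD := (@spartial R m.+1 d ord_max).
Local Notation sX := (@scoord R m.+1 d ord_max).
Local Notation En := (E ord_max).
Local Notation n := (m.+1%:R : R[i]).

Lemma clifford_basis (i j : 'I_m.+1) :
  E i *m E j + E j *m E i = (- (2 * (i == j)%:R))%:M.
Proof.
have cE k : clifford E (delta_mx 0 k) = E k.
  rewrite /clifford (bigD1 k) //= big1 => [|l lk].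
    by rewrite mxE !eqxx addr0 scale1r.
  by rewrite mxE eqxx (negbTE lk) scale0r.
have := hE (delta_mx 0 i) (delta_mx 0 j); rewrite !cE => ->; congr (_%:M).
rewrite (bigD1 i) //= big1 => [|l li]; last by rewrite !mxE (negbTE li) andbF mul0r.
rewrite !mxE !eqxx /= mul1r addr0.
by case: eqP => _; apply/eqP; rewrite eq_complex /=; apply/andP; split; apply/eqP; ring.
Qed.

Lemma En_sqr : En *m En = (-1)%:M.
Proof.
apply: (@scalerI _ _ 2); first by rewrite pnatr_eq0.
by rewrite scaler_nat mulr2n clifford_basis eqxx mulr1 scale_scalar_mx mulrN1.
Qed.

Lemma En_anti (k : 'I_m) : En *m E (lift ord_max k) = - (E (lift ord_max k) *m En).
Proof.
apply/eqP; rewrite -addr_eq0 clifford_basis (negbTE (neq_lift _ _)).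
by rewrite mulr0 oppr0 raddf0.
Qed.

(** The factors e_n cancel: e_k e_n e_l e_n = - e_k e_l e_n e_n = e_k e_l. *)
Lemma lift_mul (k l : 'I_m) :
  (E (lift ord_max k) *m En) *m (E (lift ord_max l) *m En)
  = E (lift ord_max k) *m E (lift ord_max l).
Proof.
rewrite -mulmxA (mulmxA En) En_anti mulNmx -mulmxA En_sqr mul_mx_scalar.
by rewrite scaleN1r opprK.
Qed.

(** The operator T = D' e_n ([tdirac_en_mul]). *)
Definition sT (f : sfield) : sfield :=
  \sum_(k < m) smul (E (lift ord_max k) *m En) (spartial (lift ord_max k) f).

Definition stdirac (f : sfield) : sfield :=
  \sum_(k < m) smul (E (lift ord_max k)) (spartial (lift ord_max k) f).

Lemma sT_linear : linear sT.
Proof.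
move=> a f g; rewrite /sT scaler_sumr -big_split; apply: eq_bigr => k _ /=.
by rewrite !linearP.
Qed.
HB.instance Definition _ :=
  GRing.isLinear.Build R[i] sfield sfield *:%R sT sT_linear.

Lemma sD_sX f : sD (sX f) = sX (sD f) + f.
Proof. by rewrite spartial_scoord eqxx scale1r. Qed.

Lemma sT_sX f : sT (sX f) = sX (sT f).
Proof.
rewrite /sT linear_sum; apply: eq_bigr => k _ /=.
by rewrite spartial_scoord (negbTE (neq_lift _ _)) scale0r addr0 smul_scoord.
Qed.

Lemma sD_sT f : sD (sT f) = sT (sD f).
Proof.
rewrite /sT linear_sum; apply: eq_bigr => k _ /=.
by rewrite spartial_smul spartialC.
Qed.

(** As partial derivatives commute, twice T^2 is the sum over k and l of
    (e_k e_l + e_l e_k) d_k d_l, in which only k = l contributes, with the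
    factor -2. *)
Lemma sT_sqr f : sT (sT f) = - tlap f.
Proof.
pose P k l := spartial (lift ord_max k) (spartial (lift ord_max l) f).
have TTE : sT (sT f) = \sum_(k < m) \sum_(l < m)
    smul (E (lift ord_max k) *m E (lift ord_max l)) (P k l).
  apply: eq_bigr => k _; rewrite !linear_sum; apply: eq_bigr => l _ /=.
  by rewrite spartial_smul smulM lift_mul.
apply: (@scalerI _ _ 2); first by rewrite pnatr_eq0.
rewrite scaler_nat mulr2n {2}TTE exchange_big TTE -big_split /= scalerN -scaleNr.
rewrite /tlap scaler_sumr; apply: eq_bigr => k _; rewrite -big_split /=.
rewrite (bigD1 k) //= big1 => [|l lk]; last first.
  rewrite [P l k]spartialC smulDl clifford_basis (inj_eq lift_inj) eq_sym (negbTE lk).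
  by rewrite mulr0 oppr0 smul_scalar scale0r.
by rewrite smulDl clifford_basis eqxx mulr1 smul_scalar addr0.
Qed.

Lemma iter_sT_double k f : iter (2 * k) sT f = (-1) ^+ k *: iter k (@tlap R m d) f.
Proof.
elim: k => [|k IHk]; first by rewrite scale1r.
rewrite mulnS !iterS IHk !linearZ /= sT_sqr exprS mulN1r scaleNr scalerN.
by [].
Qed.

Lemma tdirac_sfield (f : sfield) : tdirac E f = stdirac f.
Proof. by apply/funext => x; rewrite /stdirac sfield_sum. Qed.

Lemma tdirac_en_mul (f : sfield) : tdirac E (en_mul E f) = sT f.
Proof.
have -> : en_mul E f = smul En f by [].
rewrite tdirac_sfield; congr (sfield_val _); apply: eq_bigr => k _.
by rewrite spartial_smul smulM.
Qed.

Lemma smul_stdirac f : smul En (stdirac f) = - sT f.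
Proof.
rewrite /stdirac /sT linear_sum -sumrN; apply: eq_bigr => k _ /=.
by rewrite smulM En_anti smulN.
Qed.

Lemma sum_ord_max (V : zmodType) (F : 'I_m.+1 -> V) :
  \sum_(k < m.+1) F k = F ord_max + \sum_(k < m) F (lift ord_max k).
Proof.
rewrite big_ord_recr /= addrC; congr (_ + _); apply: eq_bigr => k _.
by congr F; apply: val_inj; exact: (esym (lift_max k)).
Qed.

(** D (e_n f) contributes - d_n f + T f, and Delta (x_n f) contributes
    2 d_n f + x_n (d_n^2 - T^2) f; the constants 1 - 1 + 2 add up to the 2 in
    n - 2 lambda + 2. *)
Lemma Pop_sfield lambda (f : sfield) :
  Pop E lambda f = weyl_step sD sX sT (n - 2 * lambda + 2) f.
Proof.
apply/funext => x.
have dirE : Defs.dirac E (en_mul E f) x = - sD f x + sT f x.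
  rewrite /Defs.dirac sum_ord_max -tdirac_en_mul; congr (_ + _).
  rewrite -[partial _ _ x]/(spartial ord_max (smul En f) x) spartial_smul.
  by rewrite -[LHS]/(smul En (smul En (sD f)) x) smulM En_sqr smul_scalar scaleN1r.
have lapE : laplacian (xn_mul f) x = 2 *: sD f x + sX (sD (sD f) + tlap f) x.
  rewrite /laplacian sum_ord_max.
  have -> : \sum_(k < m) partial (lift ord_max k)
      (partial (lift ord_max k) (xn_mul f)) x = sX (tlap f) x.
    rewrite /tlap linear_sum sfield_sum; apply: eq_bigr => k _ /=.
    rewrite -[LHS]/(spartial (lift ord_max k) (spartial (lift ord_max k) (sX f)) x).
    by rewrite !spartial_scoord (negbTE (neq_lift _ _)) !scale0r !addr0
      spartial_scoord (negbTE (neq_lift _ _)) scale0r addr0.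
  have DDX : sD (sD (sX f)) = 2 *: sD f + sX (sD (sD f)).
    by rewrite sD_sX linearD /= sD_sX scaler_nat mulr2n -addrA addrC.
  rewrite -[partial _ _ x]/(sD (sD (sX f)) x) DDX.
  have XD a b : sX (a + b) = sX a + sX b by rewrite linearD.
  by rewrite XD !sfieldD addrA.
rewrite /Pop dirE lapE; set c := n - 2 * lambda + 2.
rewrite -[weyl_step _ _ _ _ _]/(c *: sD f + sT f + sX (sD (sD f) - sT (sT f))).
rewrite sT_sqr opprK !sfieldD sfieldZ {}/c -[dn f x]/(sD f x).
move: (sD f x) (sT f x) (sX _ x) => u v w.
rewrite !addrA; congr (_ + w); rewrite [LHS]addrAC; congr (_ + v).
by rewrite -[- u]scaleN1r -!scalerDl; congr (_ *: _); ring.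
Qed.

Lemma Piter_sfield N lambda (f : sfield) :
  Piter E N lambda f = weyl_iter sD sX sT N (n - 2 * lambda + 2) f.
Proof.
elim: N => //= N ->; rewrite Pop_sfield; congr (sfield_val (weyl_step _ _ _ _ _)).
by ring.
Qed.

Lemma DBS_sfield M lambda (f : sfield) y :
  DBS E M lambda f y
  = \sum_(j < M.+1) bs_coef (2 * lambda - n - 2 * M%:R) M j
                      *: iter j sT (iter (M - j) sD f) (hyperplane y).
Proof.
rewrite /DBS Piter_sfield -[LHS]/(srestr _ y).
rewrite (rho_weyl_iter sD_sX sT_sX sD_sT (@srestr_scoord R m d)) fct_sumE.
apply: eq_bigr => j _; rewrite -[LHS]/(_ *: srestr _ y).
by congr (bs_coef _ _ _ *: _); ring.
Qed.

End SpinorOperators.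

(** * Comparison with the symmetry breaking operators *)

Lemma sum_parity_odd_length (V : zmodType) (F : nat -> V) (N : nat) :
  \sum_(j < (2 * N).+1) F j
  = \sum_(k < N.+1) F (2 * k)%N + \sum_(k < N) F (2 * k).+1.
Proof.
elim: N => [|N IHN]; first by rewrite muln0 !big_ord_recl !big_ord0 !addr0.
have -> : (2 * N.+1).+1 = (2 * N).+3 by lia.
rewrite 2!big_ord_recr /= IHN. rewrite [\sum_(k < N.+2) _]big_ord_recr /=.
rewrite [\sum_(k < N.+1) F (2 * _).+1]big_ord_recr /=.
have -> : (2 * N.+1)%N = (2 * N).+2 by lia.
by rewrite -!addrA; congr (_ + _); rewrite addrA addrC.
Qed.

Lemma sum_parity_even_length (V : zmodType) (F : nat -> V) (N : nat) :
  \sum_(j < (2 * N).+2) F j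
  = \sum_(k < N.+1) F (2 * k)%N + \sum_(k < N.+1) F (2 * k).+1.
Proof.
rewrite big_ord_recr /= sum_parity_odd_length [\sum_(k < N.+1) F (2 * _).+1]big_ord_recr /=.
by rewrite addrA.
Qed.

Section Assembly.
Variables (R : realType) (m d : nat) (E : 'I_m.+1 -> 'M[R[i]]_d).
Hypothesis hE : clifford_module E.
Local Notation sfield := (sfield R m.+1 d).
Local Notation sD := (@spartial R m.+1 d ord_max).
Local Notation En := (E ord_max).
Local Notation n := (m.+1%:R : R[i]).

Lemma iter_sT_doubleS j k (f : sfield) :
  iter (2 * k).+1 (sT E) (iter j sD f)
  = (-1) ^+ k *: iter k (@tlap R m d) (iter j sD (sT E f)).
Proof.
rewrite iterSr (iter_sT_double hE); congr (_ *: iter k _ _).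
by elim: j => //= j <-; rewrite sD_sT.
Qed.

Lemma sign_cancel k (c : R[i]) : c * (-1) ^+ k * (-1) ^+ k = c.
Proof. by rewrite -mulrA -expr2 sqrr_sign mulr1. Qed.

Lemma DBS_even N lambda (f : sfield) y :
  DBS E (2 * N) lambda f y
  = ((- 2) ^+ N * pochhammer (lambda - n / 2 - 2 * N%:R + 1 / 2) N
     * (dfact (2 * N - 1))%:R) *: bD_even E N (n - lambda) f y.
Proof.
rewrite (DBS_sfield hE) /bD_even D_even_sfield.
have -> : 2 * lambda - n - 2 * (2 * N)%:R = 2 * lambda - n - 4 * N%:R.
  by rewrite natrM; ring.
rewrite (sum_parity_odd_length (fun j => bs_coef (2 * lambda - n - 4 * N%:R) (2 * N) j
  *: iter j (sT E) (iter (2 * N - j) sD f) (hyperplane y))).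
rewrite scalerDr scaler_sumr; congr (_ + _).
  apply: eq_bigr => k _; rewrite (iter_sT_double hE) bs_coef_even_even; last first.
    by rewrite -ltnS.
  by rewrite sfieldZ !scalerA mulrA sign_cancel.
case: N => [|N]; first by rewrite big_ord0 scaler0.
rewrite tdirac_en_mul D_odd_sfield !scaler_sumr; apply: eq_bigr => k _.
rewrite iter_sT_doubleS bs_coef_even_odd; last by rewrite -ltnS.
have -> : (2 * N.+1 - (2 * k).+1 = 2 * N - 2 * k + 1)%N.
  by have := ltn_ord k; lia.
by rewrite sfieldZ !scalerA !mulrA sign_cancel.
Qed.

(** Multiplication by e_n from the left turns the two summands of D_(2N+1) into
    e_n e_n = -1 and e_n D' = - T, which absorb the sign of the prefactor. *)
Lemma DBS_odd N lambda (f : sfield) y :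
  DBS E (2 * N + 1) lambda f y
  = (- (- 2) ^+ N * pochhammer (lambda - n / 2 - 2 * N%:R - 1 / 2) N
     * (dfact (2 * N + 1))%:R)
    *: (En *m bD_odd E N (n - lambda) f y).
Proof.
set q := (dfact _)%:R; rewrite addn1 (DBS_sfield hE) /bD_odd tdirac_sfield.
rewrite -[en_mul E f]/(sfield_val (smul En f)).
rewrite D_odd_sfield D_even_sfield mulmxDr -scalemxAr !mulmx_sumr.
have -> : 2 * lambda - n - 2 * (2 * N).+1%:R = 2 * lambda - n - 4 * N%:R - 2.
  by rewrite -[(2 * N).+1%:R]natr1 natrM; ring.
rewrite (sum_parity_even_length (fun j => bs_coef (2 * lambda - n - 4 * N%:R - 2) (2 * N).+1 j
  *: iter j (sT E) (iter ((2 * N).+1 - j) sD f) (hyperplane y))).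
rewrite !(scalerDr, scaler_sumr); congr (_ + _); apply: eq_bigr => k _.
  have kN : (k <= N)%N by rewrite -ltnS.
  rewrite -scalemxAr -[En *m _]/(smul En _ _) iter_tlap_smul smulM (En_sqr hE).
  rewrite smul_scalar scaleN1r sfieldN (iter_sT_double hE) sfieldZ.
  have -> : ((2 * N).+1 - 2 * k = 2 * N - 2 * k + 1)%N by lia.
  rewrite (bs_coef_odd_even m lambda kN) -/q.
  by rewrite !scalerN !scalerA -scaleNr !mulrA sign_cancel; congr (_ *: _); ring.
have kN : (k <= N)%N by rewrite -ltnS.
rewrite -scalemxAr -[En *m _]/(smul En _ _) -iter_tlap_smul (smul_stdirac hE).
rewrite iter_tlap_opp sfieldN iter_sT_doubleS sfieldZ subSS (bs_coef_odd_odd m lambda kN) -/q.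
by rewrite !scalerN !scalerA -scaleNr !mulrA sign_cancel; congr (_ *: _); ring.
Qed.

End Assembly.

Theorem theorem4p6 (R : realType) (m : nat) (hm : (2 <= m.+1)%N) (d : nat)
    (E : 'I_m.+1 -> 'M[R[i]]_d)
    (hE : clifford_module E) (hirr : irreducible_module E)
    (N : nat) (lambda : R[i]) (phi : 'rV[R]_m.+1 -> 'cV[R[i]]_d)
    (hphi : spinor_field E phi) (y : 'rV[R]_m) :
  let n : R[i] := m.+1%:R in
  DBS E (2 * N) lambda phi y
  = ((- 2) ^+ N * pochhammer (lambda - n / 2 - 2 * N%:R + 1 / 2) N
     * (dfact (2 * N - 1))%:R) *: bD_even E N (n - lambda) phi y
  /\
  DBS E (2 * N + 1) lambda phi y
  = (- (- 2) ^+ N * pochhammer (lambda - n / 2 - 2 * N%:R - 1 / 2) N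
     * (dfact (2 * N + 1))%:R)
    *: (E ord_max *m bD_odd E N (n - lambda) phi y).
Proof.
case: hphi => sphi _; split.
  exact: (DBS_even hE N lambda (mk_sfield sphi) y).
exact: (DBS_odd hE N lambda (mk_sfield sphi) y).
Qed.
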